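(* Let $\mathcal{X}$ be a Polish space with its Borel $\sigma$-algebra, and let $\mathcal{P},\mathcal{Q}$ be nonempty, weakly compact, convex sets of Borel probability measures on $\mathcal{X}$. Then $$\mathrm{KL}(\mathcal{P}\parallel\mathcal{Q})=\sup_{\varphi\in C_b(\mathcal{X})}\left\{\mathbb{E}^{\mathcal{P}}[\varphi]-\log\left(\mathbb{E}^{\mathcal{Q}}[e^{\varphi}]\right)\right\}.$$
   Context: ''Weakly compact'' means compact in the topology of weak convergence of probability measures; $C_b(\mathcal{X})$ is the set of bounded continuous real functions on $\mathcal{X}$; $\log$ is the natural logarithm. For probability measures $\mu,\nu$, $\mathrm{KL}(\mu\parallel\nu)=\int_{\mathcal{X}}\log\left(\frac{d\mu}{d\nu}\right)d\mu$ if $\mu\ll\nu$, and $+\infty$ otherwise. For sets of probability measures, $\mathrm{KL}(\mathcal{P}\parallel\mathcal{Q}):=\sup_{\mu\in\mathcal{P}}\inf_{\nu\in\mathcal{Q}}\mathrm{KL}(\mu\parallel\nu)\in[0,+\infty]$. For $\varphi\in C_b(\mathcal{X})$, $\mathbb{E}^{\mathcal{P}}[\varphi]:=\sup_{\mu\in\mathcal{P}}E_\mu[\varphi]$, where $E_\mu[\varphi]=\int\varphi\,d\mu$; similarly for $\mathbb{E}^{\mathcal{Q}}$. *)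

(* Defs.v *)
From HB Require Import structures.
From mathcomp Require Import all_boot all_order all_algebra.
From mathcomp Require Import all_classical all_reals all_analysis.

Set Implicit Arguments.
Unset Strict Implicit.
Unset Printing Implicit Defensive.

Import Order.TTheory GRing.Theory Num.Theory.
Import numFieldNormedType.Exports.

Local Open Scope classical_set_scope.
Local Open Scope ring_scope.
Local Open Scope ereal_scope.
Local Open Scope charge_scope.

(* A homeomorphism onto a complete metric space amounts to a complete metric
   inducing the topology; no metric is fixed on [X] itself. *)
Definition completely_metrizable (R : realType) (X : topologicalType) : Prop :=
  exists (M : metricType R) (f : X -> M) (g : M -> X),
    [/\ cancel f g, cancel g f, continuous f, continuous g &
        forall F : set_system M, ProperFilter F -> cauchy F ->
          exists l : M, F --> l].

Definition separable (X : topologicalType) : Prop :=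
  exists2 D : set X, countable D & dense D.

Definition polish (R : realType) (X : topologicalType) : Prop :=
  completely_metrizable R X /\ separable X.

(* Generated sigma-algebras are only available over pointed types; this is no
   restriction for a space that carries a probability measure. *)
Definition borel (X : ptopologicalType) := g_sigma_algebraType (@open X).

Definition Cb (R : realType) (X : topologicalType) : set (X -> R) :=
  [set phi | continuous phi /\ bounded_fun phi].
Arguments Cb R X : clear implicits.

(* The topology of weak convergence: the coarsest one making
   mu |-> \int phi dmu continuous for every phi in C_b(X). *)
Definition weak_probability (R : realType) (X : ptopologicalType) :=
  initial_topology
    (fun (mu : probability (borel X) R) =>
       (fun phi => (\int[mu]_x (set_val phi x))%R) : {ptws (Cb R X) -> R}).

Definition weakly_compact (R : realType) (X : ptopologicalType)
    (P : set (probability (borel X) R)) : Prop :=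
  compact (P : set (weak_probability R X)).

(* A measure is a function on all subsets, whose values off the sigma-algebra
   carry no meaning: mixtures are compared on measurable sets only. *)
Definition convex_probabilities d (T : measurableType d) (R : realType)
    (P : set (probability T R)) : Prop :=
  forall mu nu, P mu -> P nu -> forall t : R, (0 <= t <= 1)%R ->
  exists2 rho, P rho & forall A, measurable A ->
    rho A = t%:E * mu A + (1 - t)%:E * nu A.

(* [lne] is -oo where the density vanishes, which only happens on a mu-null set. *)
Definition KL d (T : measurableType d) (R : realType)
    (mu nu : probability T R) : \bar R :=
  if `[< mu `<< nu >] then
    \int[mu]_x lne (('d (charge_of_finite_measure mu) '/d nu) x)
  else +oo.

Definition KL_sets d (T : measurableType d) (R : realType)
    (P Q : set (probability T R)) : \bar R :=
  ereal_sup [set ereal_inf [set KL mu nu | nu in Q] | mu in P].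

Definition upper_expectation d (T : measurableType d) (R : realType)
    (P : set (probability T R)) (phi : T -> R) : \bar R :=
  ereal_sup [set \int[mu]_x (phi x)%:E | mu in P].

(* Main.v *)
Require Import Defs.
From HB Require Import structures.
From mathcomp Require Import all_boot all_order all_algebra.
From mathcomp Require Import all_classical all_reals all_analysis.
From mathcomp Require Import measurable_realfun ring lra.

(** The easy inequality is the Donsker-Varadhan one: if [mu = g nu] and
    [\int e^psi dnu <= 1], then integrating the pointwise bound
    [psi + 1 - e^(psi - ln g) <= ln g] against [mu] gives
    [\int psi dmu <= KL mu nu] ([Donsker_Varadhan_le]).  Taking
    [psi = phi - ln S], where [S] is the upper expectation of [e^phi] over [Q],
    bounds [E_mu phi - ln S] by [KL mu nu] for every [nu] in [Q].

    For the converse, let [c] be the dual value, which may be assumed finite,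
    and fix [mu] in [P].  It suffices to find a single [nu] in [Q] such that

      (1)   e^(E_mu phi - c) <= E_nu e^phi   for all phi in C_b(X),

    and to show that (1) forces [KL mu nu <= c].

    Existence of [nu] is a minimax argument.  For a fixed [phi], condition (1)
    is closed in [nu], so by compactness of [Q] finitely many [phi_i] may be
    considered.  The conditions are then affine in [nu], and either they have a
    common solution in the convex compact set [Q], or some convex combination
    of them fails uniformly on [Q] ([convex_alternative]).  In the second case
    the convexity of [exp] turns the combination of the [e^phi_i] into the
    exponential of one bounded continuous function, which contradicts the
    definition of [c] ([finite_minimax], [compact_minimax]).

    That (1) implies [KL mu nu <= c] is the other half of Donsker-Varadhan.
    Both sides of (1) are continuous under bounded pointwise limits of [phi],
    and on a metrizable space every bounded Borel function is obtained from
    continuous ones by iterating such limits ([measurable_bounded_baire]); so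
    (1) holds for all bounded Borel [phi].  With [phi = k 1_A] it yields
    absolute continuity, and with [phi] a truncation of [ln (dmu/dnu)] it
    yields the bound on the divergence ([KL_le_of_exp_bound]). *)

Set Implicit Arguments.
Unset Strict Implicit.
Unset Printing Implicit Defensive.

Import Order.TTheory GRing.Theory Num.Theory.
Import numFieldNormedType.Exports.

Local Open Scope classical_set_scope.
Local Open Scope ring_scope.

(** * Bounded continuous functions on a metrizable space *)

Lemma CbP (R : realType) (X : ptopologicalType) (f : X -> R) :
  Cb R X f <-> continuous f /\ exists M : R, forall x, `|f x| <= M.
Proof.
have bP := @ex_bound _ _ _ f (globally setT)
  (@globally_properfilter X setT point I).
split=> [[cf /bP[M fM]]|[cf [M fM]]]; split=> //.
  by exists M => x; exact: fM.
by apply/bP; exists M => x _; exact: fM.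
Qed.

Lemma Cb_cst (R : realType) (X : ptopologicalType) (a : R) :
  Cb R X (fun=> a).
Proof. by apply/CbP; split; [move=> x; exact: cvg_cst|exists `|a|]. Qed.

Lemma CbD (R : realType) (X : ptopologicalType) (f g : X -> R) :
  Cb R X f -> Cb R X g -> Cb R X (fun x => f x + g x).
Proof.
move=> /CbP[cf [M fM]] /CbP[cg [N gN]]; apply/CbP; split.
  by move=> x; apply: cvgD; [exact: cf|exact: cg].
by exists (M + N) => x; rewrite (le_trans (ler_normD _ _))// lerD.
Qed.

Lemma CbZ (R : realType) (X : ptopologicalType) (a : R) (f : X -> R) :
  Cb R X f -> Cb R X (fun x => a * f x).
Proof.
move=> /CbP[cf [M fM]]; apply/CbP; split.
  by move=> x; apply: cvgM; [exact: cvg_cst|exact: cf].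
by exists (`|a| * M) => x; rewrite normrM ler_wpM2l.
Qed.

Lemma Cb_sum (R : realType) (X : ptopologicalType) (I : Type) (s : seq I)
    (f : I -> X -> R) :
  (forall i, Cb R X (f i)) -> Cb R X (fun x => \sum_(i <- s) f i x).
Proof.
move=> Cf; elim: s => [|i s IH].
  by under eq_fun do rewrite big_nil; exact: Cb_cst.
by under eq_fun do rewrite big_cons; exact: CbD.
Qed.

Lemma Cb_expR (R : realType) (X : ptopologicalType) (phi : X -> R) :
  Cb R X phi -> Cb R X (fun x => expR (phi x)).
Proof.
move=> /CbP[cphi [M phiM]]; apply/CbP; split.
  by move=> x; apply: continuous_comp; [exact: cphi|exact: continuous_expR].
exists (expR M) => x; rewrite ger0_norm ?expR_ge0// ler_expR.
exact: le_trans (ler_norm _) (phiM x).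
Qed.

Lemma measurable_continuous (R : realType) (X : ptopologicalType) (f : X -> R) :
  continuous f -> measurable_fun setT (f : borel X -> R).
Proof.
move=> /continuousP cf.
apply: (measurability _ (RGenOInfty.measurableE R)).
move=> _ [_ [a ->] <-]; rewrite setTI; apply: sub_sigma_algebra.
by apply: cf; exact: rray_open.
Qed.

(** The metric of the extended reals is the one pulled back along [contract]. *)
Lemma contract_continuous (R : realType) : continuous (@contract R).
Proof.
move=> x; apply/cvgrPdist_lt => e e0.
have : nbhs x (ball x e) by exact: nbhsx_ballx.
by apply: filterS => y.
Qed.

(** The function is the distance to [F], read through the homeomorphism.  That
    distance is infinite when [F] is empty; [contract] brings it into [0, 1]
    without moving its zeros. *)
Lemma metrizable_closed_zero_set (R : realType) (X : topologicalType)
    (F : set X) : completely_metrizable R X -> closed F ->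
  exists d : X -> R, [/\ continuous d, forall x, 0 <= d x <= 1 &
                       forall x, (d x == 0) <-> F x].
Proof.
move=> [M [f [g [fK gK cf cg _]]]] cF.
pose A := g @^-1` F.
have cA : closed A by apply: closed_comp => // x _; exact: cg.
exists (fun x => contract (edist_inf A (f x))); split.
- move=> x; apply: (@continuous_comp _ _ _ (fun x => edist_inf A (f x))).
    by apply: continuous_comp; [exact: cf|exact: edist_inf_continuous].
  exact: contract_continuous.
- move=> x; have := contract_le1 (edist_inf A (f x)).
  have : 0 <= contract (edist_inf A (f x)).
    by rewrite -(contract0 R) le_contract; exact: edist_inf_ge0.
  by move=> h; rewrite ger0_norm// h.
- move=> x; rewrite contract_eq0; split=> [/eqP d0|Fx]; last first.
    by apply/eqP/edist_inf0; rewrite /A/= fK.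
  suff : A (f x) by rewrite /A/= fK.
  apply: cA => B /nbhs_ballP[e /= e0 eB].
  have : (edist_inf A (f x) < e%:E)%E by rewrite d0 lte_fin.
  move=> /ereal_inf_lt[_ [a Aa <-] ae].
  by exists a; split => //; apply: eB; apply: (edist_lt_ball ae).
Qed.

(** * Bounded Borel functions as limits of continuous ones *)

(** Closure under pointwise limits of uniformly bounded sequences. *)
Definition bp_closed (R : realType) (X : Type) (H : set (X -> R)) : Prop :=
  forall (f_ : nat -> X -> R) (f : X -> R) (M : R),
    (forall n, H (f_ n)) -> (forall n x, `|f_ n x| <= M) ->
    (forall x, f_ n x @[n --> \oo] --> f x) -> H f.

(** The bounded Baire functions.  As an intersection of classes, the definition
    comes with the induction principle [baire_ind], which replaces a transfinite
    iteration of limits. *)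
Definition baire (R : realType) (X : ptopologicalType) : set (X -> R) :=
  [set f | forall H : set (X -> R), Cb R X `<=` H -> bp_closed H -> H f].
Arguments baire R X : clear implicits.

Lemma baire_bp_closed (R : realType) (X : ptopologicalType) :
  bp_closed (baire R X).
Proof.
move=> f_ f M Hf fM ff H CH cH; apply: (cH f_ f M) => // n.
exact: Hf.
Qed.

Lemma Cb_baire (R : realType) (X : ptopologicalType) : Cb R X `<=` baire R X.
Proof. by move=> f Cf H CH _; exact: CH. Qed.

Lemma baire_ind (R : realType) (X : ptopologicalType) (H : set (X -> R)) :
  Cb R X `<=` H -> bp_closed H -> baire R X `<=` H.
Proof. by move=> CH cH f bf; apply: bf. Qed.

Lemma baire_bounded (R : realType) (X : ptopologicalType) (f : X -> R) :
  baire R X f -> exists M : R, forall x, `|f x| <= M.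
Proof.
apply: (@baire_ind _ _ [set f | exists M : R, forall x, `|f x| <= M]).
  by move=> g /CbP[_].
move=> f_ g M _ fM fg; exists M => x.
exact: (ler_cvg_to (cvg_norm (fg x)) (cvg_cst M) (nearW _ (fun n => fM n x))).
Qed.

(** A good-sets argument applied twice: the [k] with [h + k] Baire form a
    [bp_closed] class, first for [h] continuous, then for [h] Baire. *)
Lemma baireD (R : realType) (X : ptopologicalType) (f g : X -> R) :
  baire R X f -> baire R X g -> baire R X (fun x => f x + g x).
Proof.
have closedD (h : X -> R) : (exists M : R, forall x, `|h x| <= M) ->
    bp_closed [set k : X -> R | baire R X (fun x => h x + k x)].
  move=> [M hM] k_ k N /= hk kN kk.
  apply: (baire_bp_closed (M := M + N) hk) => [n x|x].
    by rewrite (le_trans (ler_normD _ _))// lerD.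
  by apply: cvgD; [exact: cvg_cst|exact: kk].
have baireCbD (h k : X -> R) : Cb R X h -> baire R X k ->
    baire R X (fun x => h x + k x).
  move=> Ch; apply: (baire_ind (H := [set k | baire R X (fun x => h x + k x)])).
    by move=> l Cl; apply: Cb_baire; exact: CbD.
  by apply: closedD; case/CbP: Ch.
move=> bf; apply: (baire_ind (H := [set k | baire R X (fun x => f x + k x)])).
  2: by apply: closedD; exact: baire_bounded.
move=> h Ch /=; rewrite (_ : (fun _ => _) = (fun x => h x + f x)).
  exact: baireCbD.
by apply/funext => x; rewrite addrC.
Qed.

Lemma baireZ (R : realType) (X : ptopologicalType) (a : R) (f : X -> R) :
  baire R X f -> baire R X (fun x => a * f x).
Proof.
apply: (baire_ind (H := [set k | baire R X (fun x => a * k x)])).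
  by move=> h Ch; apply: Cb_baire; exact: CbZ.
move=> k_ k N /= hk kN kk.
apply: (baire_bp_closed (M := `|a| * N) hk) => [n x|x].
  by rewrite normrM ler_wpM2l.
by apply: cvgM; [exact: cvg_cst|exact: kk].
Qed.

Lemma baire_cst (R : realType) (X : ptopologicalType) (a : R) :
  baire R X (fun=> a).
Proof. by apply: Cb_baire; exact: Cb_cst. Qed.

Lemma baire_sum (R : realType) (X : ptopologicalType) (I : Type) (s : seq I)
    (f : I -> X -> R) : (forall i, baire R X (f i)) ->
  baire R X (fun x => \sum_(i <- s) f i x).
Proof.
move=> bf; elim: s => [|i s IH].
  by under eq_fun do rewrite big_nil; exact: baire_cst.
by under eq_fun do rewrite big_cons; exact: baireD.
Qed.

(** If [d] vanishes exactly off [U] then [1 - (1 - d)^n] increases to [\1_U]. *)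
Lemma baire_indic_open (R : realType) (X : ptopologicalType) (U : set X) :
  completely_metrizable R X -> open U -> baire R X (\1_U).
Proof.
move=> mX oU.
have [d [cd d01 d0]] := metrizable_closed_zero_set mX (open_closedC oU).
have dn n x : 0 <= (1 - d x) ^+ n <= 1.
  have /andP[d0x d1x] := d01 x.
  by rewrite exprn_ge0 ?exprn_ile1 ?subr_ge0// gerBl.
apply: (@baire_bp_closed _ _ (fun n x => 1 - (1 - d x) ^+ n) _ 1) => [n|n x|x].
- apply: Cb_baire; apply/CbP; split.
    move=> x; apply: cvgB; first exact: cvg_cst.
    apply: (@continuous_comp _ _ _ (fun x => 1 - d x) (fun y => y ^+ n)).
      by apply: cvgB; [exact: cvg_cst|exact: cd].
    exact: exprn_continuous.
  exists 1 => x; have /andP[a b] := dn n x.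
  by rewrite ger0_norm ?subr_ge0// gerBl.
- have /andP[a b] := dn n x.
  by rewrite ger0_norm ?subr_ge0// gerBl.
- have [Ux|Ux] := pselect (U x).
    rewrite indicE mem_set// -[X in _ --> X]subr0.
    apply: cvgB; first exact: cvg_cst.
    apply: cvg_expr; have /andP[a b] := d01 x.
    rewrite ger0_norm ?subr_ge0// gtrBl lt_neqAle a andbT eq_sym.
    by apply/negP => /d0.
  rewrite indicE memNset//.
  have /eqP -> : d x == 0 by apply/d0.
  under eq_fun do rewrite subr0 expr1n subrr.
  exact: cvg_cst.
Qed.

(** Open sets form a pi-system generating the Borel sets, and the sets with a
    Baire indicator form a lambda-system. *)
Lemma baire_indic (R : realType) (X : ptopologicalType) (A : set (borel X)) :
  completely_metrizable R X -> measurable A -> baire R X (\1_A : X -> R).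
Proof.
move=> mX mA.
apply: (@dynkin_induction _ (borel X) (@open X)
  [set A | baire R X (\1_A : X -> R)]) => //.
- by move=> U V; exact: openI.
- by apply: baire_indic_open => //; exact: openT.
- by move=> U oU; exact: baire_indic_open.
- move=> S _ bS /=; rewrite (_ : \1_(~` S) = fun x => 1 + (-1) * \1_S x).
    by apply: baireD; [exact: baire_cst|exact: baireZ].
  apply/funext => x; rewrite !indicE in_setC.
  by case: (x \in S); rewrite ?mulr0 ?mulr1 ?addr0 ?subrr.
- move=> F mF tF bF /=.
  pose f_ n x := \sum_(0 <= i < n) (\1_(F i) x : R).
  have f_sum n x : (f_ n x)%:E = (\sum_(0 <= i < n) (\1_(F i) x)%:E)%E.
    by rewrite sumEFin.
  have f_le n x : f_ n x <= \1_(\bigcup_k F k) x.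
    rewrite -lee_fin f_sum indic_bigcup//.
    by apply: nneseries_lim_ge => i _ _; rewrite lee_fin.
  apply: (@baire_bp_closed _ _ f_ _ 1) => [n|n x|x].
  + exact: baire_sum.
  + rewrite ger0_norm; last by apply: sumr_ge0.
    by rewrite (le_trans (f_le n x))// indicE; case: (_ \in _).
  + have /fine_cvgP[_ //] : (f_ n x)%:E @[n --> \oo] -->
        (\1_(\bigcup_k F k) x : R)%:E.
    rewrite indic_bigcup//; under eq_fun do rewrite f_sum.
    by apply: is_cvg_nneseries => i _ _; rewrite lee_fin.
Qed.

Section simple_functions.
Import HBNNSimple.

(** A nonnegative bounded function is a bounded limit of simple functions; the
    general case follows by adding a constant. *)
Lemma measurable_bounded_baire (R : realType) (X : ptopologicalType)
    (f : borel X -> R) : completely_metrizable R X ->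
  measurable_fun setT f -> (exists M : R, forall x, `|f x| <= M) -> baire R X f.
Proof.
move=> mX mf [M fM].
pose g x := (f x + M)%:E.
have g0 x : (0 <= g x)%E.
  by rewrite lee_fin -lerBlDr sub0r; have := fM x; rewrite ler_norml => /andP[].
have mg : measurable_fun setT g.
  by apply/measurable_EFinP; apply: measurable_funD.
pose h := nnsfun_approx measurableT mg.
suff : baire R X (fun x => f x + M).
  move=> /(baireD (@baire_cst R X (- M))); congr baire.
  by apply/funext => x; rewrite addrCA addNr addr0.
have hg x n : ((h n x)%:E <= g x)%E.
  by rewrite /h nnsfun_approxE le_approx.
apply: (@baire_bp_closed _ _ (fun n => h n) _ (M + M)) => [n|n x|x].
- rewrite (_ : (h n : _ -> _) = fun x =>
      \sum_(y <- finmap.enum_fset (fset_set (range (h n))))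
         y * \1_(h n @^-1` [set y]) x).
    apply: baire_sum => y; apply: baireZ; exact: baire_indic.
  by apply/funext => x; rewrite fimfunE fsbig_finite.
- rewrite ger0_norm//.
  have := hg x n; rewrite lee_fin => /le_trans; apply.
  by rewrite lerD2r (le_trans (ler_norm _)).
- by have /fine_cvgP[] :=
    @cvg_nnsfun_approx _ _ _ _ measurableT _ mg (fun x _ => g0 x) x I.
Qed.

End simple_functions.

(** * Integrals against a probability measure *)

(** With the convention [+oo - +oo = -oo], the integral of any measurable
    function is monotone, since positive and negative parts are. *)
Lemma le_measurable_integral d (T : measurableType d) (R : realType)
    (mu : {measure set T -> \bar R}) (f g : T -> \bar R) :
  measurable_fun setT f -> measurable_fun setT g -> (forall x, f x <= g x)%E ->
  (\int[mu]_x f x <= \int[mu]_x g x)%E.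
Proof.
move=> mf mg fg; rewrite integralE [leRHS]integralE; apply: leeB.
- apply: ge0_le_integral => //; first exact: measurable_funepos.
    exact: measurable_funepos.
  by move=> x _; apply: (@funepos_le _ _ setT) => //; rewrite inE.
- apply: ge0_le_integral => //; first exact: measurable_funeneg.
    exact: measurable_funeneg.
  by move=> x _; apply: (@funeneg_le _ _ setT) => //; rewrite inE.
Qed.

Lemma integrable_bounded d (T : measurableType d) (R : realType)
    (mu : probability T R) (f : T -> R) : measurable_fun setT f ->
  (exists M : R, forall x, `|f x| <= M) -> mu.-integrable setT (EFin \o f).
Proof.
move=> mf [M fM]; apply: measurable_bounded_integrable => //.
  by rewrite -ge0_fin_numE ?fin_num_measure.
exists M; split; first exact: num_real.
by move=> N MN x _ /=; rewrite (le_trans (fM x))// ltW.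
Qed.

Lemma integral_cst_probability d (T : measurableType d) (R : realType)
    (mu : probability T R) (a : R) : (\int[mu]__ a%:E = a%:E)%E.
Proof.
by rewrite integral_cst// -[RHS]mule1; congr mule; exact: probability_setT.
Qed.

Lemma Rintegral_cst_probability d (T : measurableType d) (R : realType)
    (mu : probability T R) (a : R) : \int[mu]__ a = a.
Proof. by rewrite /Rintegral integral_cst_probability. Qed.

Lemma integrable_cst_probability d (T : measurableType d) (R : realType)
    (mu : probability T R) (a : R) : mu.-integrable setT (EFin \o cst a).
Proof. by apply: integrable_bounded => //; exists `|a|. Qed.

Lemma Cb_integrable (R : realType) (X : ptopologicalType) (phi : X -> R)
    (mu : probability (borel X) R) :
  Cb R X phi -> mu.-integrable setT (EFin \o phi).
Proof.
move=> /CbP[cphi bphi]; apply: integrable_bounded => //.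
exact: measurable_continuous.
Qed.

(** * The relative entropy in terms of a real density *)

(** The derivative used in [KL] is determined up to a [nu]-null set, and may be
    negative on one.  Replacing it by a nonnegative real version makes the
    change of variables hold for all nonnegative functions, and lets [ln] stand
    for [lne]: the two differ where the density vanishes (there [ln 0 = 0]), a
    set that [mu] does not charge. *)
Lemma KL_density d (T : measurableType d) (R : realType)
    (mu nu : probability T R) : mu `<< nu ->
  exists g : T -> R, [/\ measurable_fun setT g, forall x, 0 <= g x,
    forall f : T -> \bar R, (forall x, 0 <= f x)%E -> measurable_fun setT f ->
      (\int[mu]_x f x = \int[nu]_x (f x * (g x)%:E))%E,
    \forall x \ae mu, 0 < g x &
    KL mu nu = (\int[mu]_x (ln (g x))%:E)%E].
Proof.
move=> munu.
pose f := Radon_Nikodym_SigmaFinite.f mu nu.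
have f0 x : (0 <= f x)%E by exact: Radon_Nikodym_SigmaFinite.f_ge0.
have ffin x : f x \is a fin_num by exact: Radon_Nikodym_SigmaFinite.f_fin_num.
have mf : measurable_fun setT f.
  exact/measurable_int/(Radon_Nikodym_SigmaFinite.f_integrable munu).
have change h : (forall x, 0 <= h x)%E -> measurable_fun setT h ->
    (\int[mu]_x h x = \int[nu]_x (h x * (fine (f x))%:E))%E.
  move=> h0 mh; under [RHS]eq_integral do rewrite fineK//.
  by rewrite Radon_Nikodym_SigmaFinite.change_of_variables.
have mff : measurable_fun setT (fine \o f) by exact: measurableT_comp.
have ff0 x : 0 <= fine (f x) by exact: fine_ge0.
exists (fine \o f).
have mZ : measurable (f @^-1` [set 0%E]).
  by rewrite -[X in measurable X]setTI; exact: mf.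
have muZ : mu (f @^-1` [set 0%E]) = 0%E.
  rewrite -[f @^-1` _]setTI setIC -integral_indic//.
  rewrite change//; last by apply/measurable_EFinP.
  apply: integral0_eq => x _; rewrite indicE.
  have [/set_mem /= ->|_] := boolP (x \in _); last by rewrite mul0e.
  by rewrite mule0.
have fpos : \forall x \ae mu, 0 < fine (f x).
  exists (f @^-1` [set 0%E]); split=> // x /= /negP; rewrite -leNgt => fx0.
  rewrite -(fineK (ffin x)); congr EFin; apply/eqP.
  by rewrite eq_le fx0 fine_ge0.
split => //.
rewrite /KL asboolT//.
set D := Radon_Nikodym _ _.
have Dfin x : D x \is a fin_num by exact: Radon_Nikodym_fin_num.
have mD : measurable_fun setT D.
  by apply: measurable_int; exact: Radon_Nikodym_integrable.
have lneD x : lne (D x) =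
    if fine (D x) <= 0 then -oo%E else (ln (fine (D x)))%:E.
  by rewrite -{1}(fineK (Dfin x)).
apply: ae_eq_integral => //.
- under eq_fun do rewrite lneD; apply: measurable_fun_ifT => //.
  + by apply: measurable_fun_ler => //; exact: measurableT_comp.
  + by apply/measurable_EFinP/measurableT_comp => //; exact: measurableT_comp.
- by apply/measurable_EFinP/measurableT_comp => //; exact: measurableT_comp.
- have fD : ae_eq mu setT f D.
    apply: (null_dominates_ae_eq measurableT munu).
    exact: (ae_eq_Radon_Nikodym_SigmaFinite munu measurableT).
  apply: filterS2 fD fpos => x fDx fx0 _.
  by rewrite lneD -fDx// leNgt fx0.
Qed.

(** * Donsker-Varadhan: lower bound on the relative entropy *)

(** With [h = e^(psi - ln g)], the inequality [1 + y <= e^y] gives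
    [psi + 1 - h <= ln g].  The left side is [mu]-integrable and
    [\int h dmu = \int h g dnu <= \int e^psi dnu <= 1]. *)
Lemma Donsker_Varadhan_le d (T : measurableType d) (R : realType)
    (mu nu : probability T R) (psi : T -> R) : measurable_fun setT psi ->
  (exists M : R, forall x, `|psi x| <= M) ->
  (\int[nu]_x (expR (psi x))%:E <= 1)%E ->
  (\int[mu]_x (psi x)%:E <= KL mu nu)%E.
Proof.
move=> mpsi bpsi nupsi.
have [munu|nmunu] := pselect (mu `<< nu); last by rewrite /KL asboolF// leey.
have [g [mg g0 change _ ->]] := KL_density munu.
pose h x := expR (psi x - ln (g x)).
have mlng : measurable_fun setT (fun x => ln (g x)) by exact: measurableT_comp.
have mh : measurable_fun setT h.
  by apply: measurableT_comp => //; exact: measurable_funB.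
have hint : (\int[mu]_x (h x)%:E <= 1)%E.
  rewrite change//; last 2 first.
  + by move=> x; rewrite lee_fin expR_ge0.
  + exact/measurable_EFinP.
  apply: le_trans nupsi; apply: ge0_le_integral => //.
  + by move=> x _; rewrite mule_ge0 ?lee_fin ?expR_ge0.
  + by apply: emeasurable_funM; apply/measurable_EFinP.
  + by apply/measurable_EFinP; exact: measurableT_comp.
  + move=> x _; rewrite -EFinM lee_fin /h.
    have [->|gx] := eqVneq (g x) 0; first by rewrite mulr0 expR_ge0.
    by rewrite expRB lnK ?posrE ?lt_neqAle 1?eq_sym ?gx ?g0// divfK.
have ih : mu.-integrable setT (EFin \o h).
  apply/integrableP; split; first exact/measurable_EFinP.
  under eq_integral do rewrite /= ger0_norm ?expR_ge0//.
  by rewrite (le_lt_trans hint)// ltry.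
have ipsi1 : mu.-integrable setT (EFin \o (fun x => psi x + 1)).
  apply: integrable_bounded; first exact: measurable_funD.
  case: bpsi => M psiM; exists (M + 1) => x.
  by rewrite (le_trans (ler_normD _ _))// normr1 lerD2r.
have ipsi := integrable_bounded mu mpsi bpsi.
apply: (@le_trans _ _ (\int[mu]_x (psi x + 1 - h x)%:E)%E); last first.
  apply: le_measurable_integral.
  - by apply/measurable_EFinP/measurable_funB => //; exact: measurable_funD.
  - exact/measurable_EFinP.
  - move=> x; rewrite lee_fin.
    by have := expR_ge1Dx (psi x - ln (g x)); rewrite -/(h x); lra.
under [leRHS]eq_integral do rewrite EFinB.
rewrite integralB_EFin//.
under [X in (_ <= X - _)%E]eq_integral do rewrite EFinD.
rewrite integralD//; last exact: integrable_cst_probability.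
rewrite integral_cst_probability.
have hfin : (\int[mu]_x (h x)%:E)%E \is a fin_num.
  exact: (integrable_fin_num measurableT ih).
by rewrite leeBrDr// leeD2l.
Qed.

(** * Donsker-Varadhan: upper bound on the relative entropy *)

(** If [nu A = 0], the function [k 1_A] turns the hypothesis into
    [k mu(A) <= c], for every [k]. *)
Lemma dominates_of_exp_bound d (T : measurableType d) (R : realType)
    (mu nu : probability T R) (c : R) :
  (forall phi : T -> R, measurable_fun setT phi ->
     (exists M : R, forall x, `|phi x| <= M) ->
     expR (\int[mu]_x phi x - c) <= \int[nu]_x expR (phi x)) ->
  mu `<< nu.
Proof.
move=> H; apply/null_content_dominatesP => A mA nuA.
have iA (m : probability T R) : m.-integrable setT (EFin \o (\1_A : T -> R)).
  apply: integrable_bounded => //; exists 1 => x; rewrite indicE.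
  by case: (x \in A); rewrite ?normr1 ?normr0.
have RA (m : probability T R) : \int[m]_x (\1_A x : R) = fine (m A).
  by rewrite /Rintegral integral_indic// setIT.
have kA (k : nat) : k%:R * fine (mu A) <= c.
  have mk : measurable_fun setT (fun x => k%:R * \1_A x : R).
    by apply: measurable_funM => //; exact: measurable_indic.
  have bk : exists M : R, forall x, `|k%:R * \1_A x : R| <= M.
    exists k%:R => x; rewrite normrM normr_nat indicE.
    by case: (x \in A); rewrite ?normr1 ?normr0 ?mulr1 ?mulr0.
  have := H _ mk bk.
  have muk : \int[mu]_x (k%:R * \1_A x) = k%:R * fine (mu A).
    by rewrite RintegralZl ?RA//; exact: iA.
  rewrite muk; have -> : \int[nu]_x expR (k%:R * \1_A x) = 1.
    under eq_Rintegral => x _.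
      rewrite (_ : expR _ = 1 + (expR k%:R - 1) * \1_A x); last first.
        rewrite indicE; case: (x \in A); rewrite ?mulr1 ?mulr0 ?expR0 ?addr0//.
        by rewrite addrC subrK.
      over.
    rewrite RintegralD//; last 2 first.
    - exact: integrable_cst_probability.
    - have := integrableZl measurableT (expR k%:R - 1) (iA nu).
      by apply: eq_integrable.
    rewrite RintegralZl//; last exact: iA.
    have nu0 : \int[nu]_x (\1_A x : R) = 0 by rewrite RA nuA.
    rewrite [X in _ + _ * X](_ : _ = 0); last exact: nu0.
    by rewrite mulr0 addr0 Rintegral_cst_probability.
  by rewrite -[X in _ <= X -> _]expR0 ler_expR subr_le0.
have muAfin : mu A \is a fin_num by exact: fin_num_measure.
have muA0 : 0 <= fine (mu A) by exact: fine_ge0.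
rewrite -(fineK muAfin); congr EFin; apply/eqP; rewrite eq_le muA0 andbT leNgt.
apply/negP => muApos.
have := kA (Num.truncn (c / fine (mu A))).+1.
apply/negP; rewrite -ltNge -ltr_pdivrMr//.
exact: truncnS_gt.
Qed.

(** The test functions are [phi = ln (max (min g n) dl)].  Since
    [e^phi <= g + dl], the hypothesis gives [\int phi dmu <= c + dl].  The
    positive part of [phi] does not depend on [dl <= 1], and its negative part
    is at most that of [ln g] almost surely, so
    [\int (ln (min g n))^+ dmu <= c + \int (ln g)^- dmu] once [dl] tends to 0.
    Monotone convergence in [n] concludes. *)
Lemma KL_le_of_exp_bound d (T : measurableType d) (R : realType)
    (mu nu : probability T R) (c : R) :
  (forall phi : T -> R, measurable_fun setT phi ->
     (exists M : R, forall x, `|phi x| <= M) ->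
     expR (\int[mu]_x phi x - c) <= \int[nu]_x expR (phi x)) ->
  (KL mu nu <= c%:E)%E.
Proof.
move=> H; have munu := dominates_of_exp_bound H.
have [g [mg g0 change gpos ->]] := KL_density munu.
pose m (n : nat) x := Num.min (g x) n.+1%:R.
have mm n : measurable_fun setT (m n) by exact: measurable_minr.
have m0 n x : 0 <= m n x by rewrite le_min g0/=.
have mlng : measurable_fun setT (fun x => (ln (g x))%:E).
  by apply/measurable_EFinP; exact: measurableT_comp.
rewrite integralE.
set B := (\int[mu]_x (fun x => (ln (g x))%:E)^\- x)%E.
have B0 : (0 <= B)%E by exact: integral_ge0.
(* If the negative part has infinite integral, the whole integral is [-oo]. *)
have [Binf|Bfin] := eqVneq B +oo%E; first by rewrite Binf addeNy leNye.
have {}Bfin : B \is a fin_num by rewrite ge0_fin_numE// ltey.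
rewrite leeBlDr//.
pose p n x := (Num.max (ln (m n x)) 0)%:E.
have p_le n : (\int[mu]_x p n x <= c%:E + B)%E.
  apply/lee_addgt0Pr => e e0.
  pose dl := Num.min e 1.
  have dl0 : 0 < dl by rewrite lt_min e0 ltr01.
  have dl1 : dl <= 1 by rewrite ge_min lexx orbT.
  pose phi x := ln (Num.max (m n x) dl).
  have max0 x : 0 < Num.max (m n x) dl by rewrite lt_max dl0 orbT.
  have mphi : measurable_fun setT phi.
    by apply: measurableT_comp => //; exact: measurable_maxr.
  have bphi : exists M : R, forall x, `|phi x| <= M.
    exists (Num.max (ln n.+1%:R) (- ln dl)) => x.
    rewrite ler_norml oppr_max opprK.
    have h1 : dl <= Num.max (m n x) dl by rewrite le_max lexx orbT.
    have h2 : Num.max (m n x) dl <= n.+1%:R.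
      by rewrite ge_max ge_min lexx orbT/= (le_trans dl1)// ler1n.
    rewrite ge_min le_max; apply/andP; split; apply/orP; [right|left].
      by rewrite ler_ln ?posrE.
    by rewrite ler_ln ?posrE.
  have iphi := integrable_bounded mu mphi bphi.
  have nuphi : \int[nu]_x expR (phi x) <= 1 + dl.
    have g1 : (\int[nu]_x (g x)%:E = 1)%E.
      transitivity (\int[mu]__ 1%:E)%E; last first.
        exact: integral_cst_probability.
      rewrite change => [|x|]; [|by rewrite lee_fin|exact: measurable_cst].
      by under [RHS]eq_integral do rewrite mul1e.
    have gdl : (\int[nu]_x (g x + dl)%:E = (1 + dl)%:E)%E.
      under eq_integral do rewrite EFinD.
      rewrite ge0_integralD//; last 3 first.
      - by move=> x _; rewrite lee_fin.
      - exact/measurable_EFinP.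
      - by move=> x _; rewrite lee_fin ltW.
      by rewrite g1 integral_cst_probability.
    have : (\int[nu]_x (expR (phi x))%:E <= (1 + dl)%:E)%E.
      rewrite -gdl; apply: ge0_le_integral => //.
      - by apply/measurable_EFinP; exact: measurableT_comp.
      - by apply/measurable_EFinP; exact: measurable_funD.
      - move=> x _; rewrite lee_fin /phi lnK ?posrE// ge_max.
        rewrite lerDr g0 andbT (@le_trans _ _ (g x)) ?ge_min ?lexx//.
        by rewrite lerDl ltW.
    move=> /[dup] h; rewrite -(@fineK _ (\int[nu]_x _)%E) ?lee_fin//.
    rewrite ge0_fin_numE ?(le_lt_trans h) ?ltry//.
    by apply: integral_ge0 => x _; rewrite lee_fin expR_ge0.
  have muphi : (\int[mu]_x (phi x)%:E <= (c + e)%:E)%E.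
    rewrite -(fineK (integrable_fin_num measurableT iphi)) lee_fin.
    rewrite -lerBlDl (@le_trans _ _ dl) ?ge_min ?lexx// -ler_expR.
    exact: le_trans (H phi mphi bphi) (le_trans nuphi (expR_ge1Dx dl)).
  have phip x : (EFin \o phi)^\+%E x = p n x.
    rewrite /p /phi funeposE/= -EFin_max; congr EFin.
    have [ml|ml] := leP (m n x) dl; last by [].
    have lnle0 y : 0 <= y -> y <= dl -> ln y <= 0.
      by move=> y0 yd; apply: ln_le0; exact: le_trans dl1.
    by rewrite !max_r ?lnle0// ltW.
  have phin : (\int[mu]_x (EFin \o phi)^\-%E x <= B)%E.
    apply: ae_ge0_le_integral => //.
    - by apply: measurable_funeneg; apply/measurable_EFinP.
    - exact: measurable_funeneg.
    apply: filterS gpos => x gx _.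
    rewrite !funenegE/= -!EFin_max lee_fin.
    rewrite ge_max [X in _ && X]le_max lexx orbT andbT.
    have [gn|gn] := leP (g x) n.+1%:R.
      rewrite le_max lerN2 /phi ler_ln ?posrE// /m min_l//.
      by rewrite le_max lexx.
    rewrite le_max; apply/orP; right; rewrite oppr_le0; apply: ln_ge0.
    by rewrite le_max /m min_r ?ler1n// ltW.
  move: muphi; rewrite integralE.
  under eq_integral do rewrite phip.
  set B' := (\int[mu]_x _^\-%E x)%E in phin *.
  have B'0 : (0 <= B')%E by exact: integral_ge0.
  have B'fin : B' \is a fin_num.
    by rewrite ge0_fin_numE// (le_lt_trans phin)// ltey_eq Bfin.
  rewrite leeBlDr// => /le_trans; apply.
  by rewrite EFinD -addeA [(e%:E + _)%E]addeC addeA leeD2r// leeD2l.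
have -> : (fun x => (ln (g x))%:E)^\+%E = fun x => limn (p ^~ x).
  apply/funext => x; rewrite funeposE/= -EFin_max; apply/esym/cvg_lim => //.
  apply: cvg_near_cst; exists (Num.truncn (g x)) => // n /= gn.
  by rewrite /p /m min_l// ltW// (lt_le_trans (truncnS_gt _))// ler_nat ltnS.
have cvgp : (\int[mu]_x p n x @[n --> \oo] --> \int[mu]_x limn (p ^~ x))%E.
  apply: cvg_monotone_convergence => //.
  - move=> n; apply/measurable_EFinP; apply: measurable_maxr => //.
    exact: measurableT_comp.
  - by move=> n x _; rewrite lee_fin le_max lexx orbT.
  - move=> x _ i j ij; rewrite lee_fin.
    rewrite ge_max [X in _ && X]le_max lexx orbT andbT le_max.
    have [mi0|mi0] := leP (m i x) 0; first by rewrite ln0// lexx orbT.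
    rewrite ler_ln ?posrE//.
    + by rewrite /m le_min !ge_min lexx ler_nat ltnS ij orbT.
    + rewrite (lt_le_trans mi0)// /m le_min !ge_min lexx ler_nat ltnS ij.
      by rewrite orbT.
rewrite -(cvg_lim _ cvgp)//; apply: lime_le.
  by apply/cvg_ex; eexists; exact: cvgp.
by apply: nearW.
Qed.

(** * From bounded continuous to bounded Borel test functions *)

Lemma Rintegral_bounded_cvg d (T : measurableType d) (R : realType)
    (m : probability T R) (f_ : nat -> T -> R) (f : T -> R) (M : R) :
  (forall n, measurable_fun setT (f_ n)) -> (forall n x, `|f_ n x| <= M) ->
  (forall x, f_ n x @[n --> \oo] --> f x) ->
  \int[m]_x f_ n x @[n --> \oo] --> \int[m]_x f x.
Proof.
move=> mf fM ff.
have mlim : measurable_fun setT f.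
  exact: (measurable_fun_cvg mf (fun x _ => ff x)).
have fM' : exists M : R, forall x, `|f x| <= M.
  exists M => x.
  exact: (ler_cvg_to (cvg_norm (ff x)) (cvg_cst M) (nearW _ (fun n => fM n x))).
have intf := integrable_bounded m mlim fM'.
have : (\int[m]_x (f_ n x)%:E @[n --> \oo] --> \int[m]_x (f x)%:E)%E.
  apply: (@dominated_cvg _ _ _ m setT _ _ _ (cst M%:E)) => //.
  - by move=> n; exact/measurable_EFinP.
  - by move=> x _; apply/fine_cvgP; split; [exact: nearW|exact: ff].
  - exact: integrable_cst_probability.
  - by move=> n x _; rewrite lee_fin.
rewrite -(fineK (integrable_fin_num measurableT intf)) => /fine_cvgP[_].
by [].
Qed.

(** By dominated convergence, the functions satisfying the inequality form a
    [bp_closed] class. *)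
Lemma exp_bound_measurable (R : realType) (X : ptopologicalType)
    (mu nu : probability (borel X) R) (c : R) : completely_metrizable R X ->
  (forall phi, Cb R X phi ->
     expR (\int[mu]_x phi x - c) <= \int[nu]_x expR (phi x)) ->
  forall phi : borel X -> R, measurable_fun setT phi ->
    (exists M : R, forall x, `|phi x| <= M) ->
    expR (\int[mu]_x phi x - c) <= \int[nu]_x expR (phi x).
Proof.
move=> mX H phi mphi bphi.
have : baire R X phi by exact: measurable_bounded_baire.
pose P (f : borel X -> R) := measurable_fun setT f /\
   expR (\int[mu]_x f x - c) <= \int[nu]_x expR (f x).
suff : baire R X `<=` P by move=> /(_ phi) /[apply] -[].
apply: baire_ind => [f Cf|f_ f M Pf fM ff].
  by split; [case/CbP: Cf => cf _; exact: measurable_continuous|exact: H].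
have mf : measurable_fun setT (f : borel X -> R).
  exact: (measurable_fun_cvg (fun n => (Pf n).1) (fun x _ => ff x)).
split => //.
have l1 : expR (\int[mu]_x f_ n x - c) @[n --> \oo] -->
    expR (\int[mu]_x f x - c).
  apply: continuous_cvg; first exact: continuous_expR.
  apply: cvgB; last exact: cvg_cst.
  by apply: (@Rintegral_bounded_cvg _ _ _ _ _ _ M) => // n; exact: (Pf n).1.
have l2 : \int[nu]_x expR (f_ n x) @[n --> \oo] --> \int[nu]_x expR (f x).
  apply: (@Rintegral_bounded_cvg _ _ _ _ _ _ (expR M)) => [n|n x|x].
  - by apply: measurableT_comp => //; exact: (Pf n).1.
  - by rewrite ger0_norm ?expR_ge0// ler_expR (le_trans (ler_norm _)).
  - by apply: continuous_cvg; [exact: continuous_expR|exact: ff].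
by apply: (ler_cvg_to l1 l2); apply: nearW => n; exact: (Pf n).2.
Qed.

Lemma KL_le_of_Cb_exp_bound (R : realType) (X : ptopologicalType)
    (mu nu : probability (borel X) R) (c : R) : completely_metrizable R X ->
  (forall phi, Cb R X phi ->
     expR (\int[mu]_x phi x - c) <= \int[nu]_x expR (phi x)) ->
  (KL mu nu <= c%:E)%E.
Proof.
by move=> mX H; apply: KL_le_of_exp_bound; exact: exp_bound_measurable.
Qed.

(** * Convexity and continuity of expectations in the measure *)

Lemma continuous_expectation (R : realType) (X : ptopologicalType)
    (phi : X -> R) : Cb R X phi ->
  continuous (fun nu : weak_probability R X => \int[nu]_x phi x).
Proof.
move=> Cphi.
pose F (nu : probability (borel X) R) :=
  (fun f => \int[nu]_x (set_val f x)) : {ptws (Cb R X) -> R}.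
have cF : continuous (F : weak_probability R X -> _).
  exact: (@initial_continuous _ _ F).
pose i : Cb R X := SigSub (mem_set Cphi).
have ci : continuous (proj i : {ptws (Cb R X) -> R} -> R).
  exact: proj_continuous.
move=> nu; exact: (@continuous_comp _ _ _ (F : weak_probability R X -> _)
  (proj i) nu (cF nu) (ci (F nu))).
Qed.

Lemma Rintegral_mixture d (T : measurableType d) (R : realType)
    (mu nu rho : probability T R) (t : R) (f : T -> R) : 0 <= t <= 1 ->
  (forall A, measurable A -> rho A = t%:E * mu A + (1 - t)%:E * nu A)%E ->
  measurable_fun setT f -> (forall x, 0 <= f x) ->
  (exists M : R, forall x, `|f x| <= M) ->
  \int[rho]_x f x = t * \int[mu]_x f x + (1 - t) * \int[nu]_x f x.
Proof.
move=> /andP[t0 t1] rhoE mf f0 bf.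
have s0 : 0 <= 1 - t by rewrite subr_ge0.
have emf : measurable_fun setT (EFin \o f) by exact/measurable_EFinP.
have ef0 x : setT x -> (0 <= (EFin \o f) x)%E by rewrite lee_fin.
rewrite /Rintegral (eq_measure_integral
  (measure_add (mscale (NngNum t0) mu) (mscale (NngNum s0) nu))); last first.
  move=> A mA _; transitivity (t%:E * mu A + (1 - t)%:E * nu A)%E.
    exact: rhoE.
  by rewrite /measure_add/= /msum 2!big_ord_recl big_ord0 adde0.
rewrite ge0_integral_measure_add// !ge0_integral_mscale//.
have fin m := integrable_fin_num measurableT
  (@integrable_bounded _ _ _ m _ mf bf).
by rewrite fineD ?fineM// fin_numM//; exact: fin.
Qed.

(** * A theorem of the alternative on a compact convex set *)

Lemma continuous_sum (R : realType) (T : topologicalType) (I : Type)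
    (s : seq I) (f : I -> T -> R) : (forall i, continuous (f i)) ->
  continuous (fun x => \sum_(i <- s) f i x).
Proof.
move=> cf; elim: s => [|i s IH] x.
  by under eq_fun do rewrite big_nil; exact: cvg_cst.
under eq_fun do rewrite big_cons.
by apply: cvgD; [exact: cf|exact: IH].
Qed.

(** The image of [Q] under the [b i] is a compact convex subset of a Euclidean
    space, and the statement separates it from the nonnegative orthant.  The
    separating weights come from least squares: let [c] minimise
    [G = \sum_i (b i)^-^2] over [Q] and put [d i = (b i c)^-].  If [d = 0] then
    [c] solves the system.  Otherwise optimality of [c] along the segment from
    [c] to [y] reads [\sum_i d i * (b i y - b i c) <= 0], and
    [\sum_i d i * b i c = - \sum_i d i ^+ 2 < 0]; the weights are [d],
    normalised. *)
Lemma convex_alternative (R : realType) (T : topologicalType) (I : finType)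
    (Q : set T) (b : I -> T -> R) :
  Q !=set0 -> compact Q -> (forall i, continuous (b i)) ->
  (forall x y, Q x -> Q y -> forall t, 0 <= t <= 1 ->
     exists2 z, Q z & forall i, b i z = t * b i x + (1 - t) * b i y) ->
  (exists2 x, Q x & forall i, 0 <= b i x) \/
  (exists lam : I -> R, [/\ forall i, 0 <= lam i, \sum_i lam i = 1 &
     exists2 r, r < 0 & forall x, Q x -> \sum_i lam i * b i x <= r]).
Proof.
move=> Q0 cQ cb convQ.
pose G x := \sum_i Num.max 0 (- b i x) ^+ 2.
have cG : continuous G.
  apply: continuous_sum => i x.
  apply: (@continuous_comp _ _ _ (fun x => Num.max 0 (- b i x))
    (fun y : R => y ^+ 2)); last exact: exprn_continuous.
  by apply: continuous_max; [exact: cvg_cst|apply: cvgN; exact: cb].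
have [c /set_mem Qc cmin] := compact_EVT_min Q0 cQ (continuous_subspaceT cG).
pose d i := Num.max 0 (- b i c).
have d0 i : 0 <= d i by rewrite le_max lexx.
have [dall|/existsNP[i0 di0]] := pselect (forall i, d i = 0).
  left; exists c => // i; have : - b i c <= 0.
    by rewrite -(dall i) le_max lexx orbT.
  by rewrite oppr_le0.
right.
have Dpos : 0 < \sum_i d i.
  rewrite (bigD1 i0)//= ltr_pwDl// ?sumr_ge0// lt_neqAle d0 andbT eq_sym.
  exact/eqP.
exists (fun i => d i / \sum_i d i); split.
- by move=> i; rewrite divr_ge0// ltW.
- by rewrite -mulr_suml divff// gt_eqF.
have key y : Q y -> \sum_i d i * (b i y - b i c) <= 0.
  move=> Qy; rewrite leNgt; apply/negP.
  set S := \sum_i _ => S0.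
  pose W := \sum_i (b i y - b i c) ^+ 2.
  have W0 : 0 <= W by apply: sumr_ge0 => i _; exact: sqr_ge0.
  (* [(u^-)^2] has second derivative at most 2, hence this Taylor bound. *)
  have quad (u v : R) : Num.max 0 (- u) ^+ 2 <=
      Num.max 0 (- v) ^+ 2 - 2 * Num.max 0 (- v) * (u - v) + (u - v) ^+ 2.
    have [u0|u0] := leP 0 (- u); have [v0|v0] := leP 0 (- v).
    - lra.
    - nra.
    - by have := sqr_ge0 (- v - (u - v)); lra.
    - by have := sqr_ge0 (u - v); lra.
  have le_t t : 0 < t -> t <= 1 -> 2 * S <= t * W.
    move=> t0 t1.
    have t01 : 0 <= t <= 1 by rewrite (ltW t0).
    have [z Qz zE] := convQ y c Qy Qc t t01.
    have Gz : G z <= G c - 2 * t * S + t ^+ 2 * W.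
      rewrite /G /S /W !mulr_sumr -sumrB -big_split/=; apply: ler_sum => i _.
      apply: le_trans (quad (b i z) (b i c)) _.
      rewrite zE -/(d i) le_eqVlt; apply/orP; left; apply/eqP; ring.
    have := le_trans (cmin z (mem_set Qz)) Gz.
    move=> h; rewrite -(ler_pM2l t0); lra.
  (* For this [t], [t * W <= S < 2 * S], against [le_t]. *)
  have t1 : Num.min 1 (S / (W + 1)) <= 1 by rewrite ge_min lexx.
  have t0 : 0 < Num.min 1 (S / (W + 1)).
    by rewrite lt_min ltr01/= divr_gt0// ltr_wpDl.
  have := le_t _ t0 t1.
  have : Num.min 1 (S / (W + 1)) * W <= S.
    rewrite (@le_trans _ _ (S / (W + 1) * W))//.
      by rewrite ler_wpM2r// ge_min lexx orbT.
    rewrite mulrAC ler_pdivrMr ?ltr_wpDl//; nra.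
  lra.
exists (- (\sum_i d i ^+ 2) / \sum_i d i).
  rewrite mulNr oppr_lt0 divr_gt0//.
  rewrite (bigD1 i0)//= ltr_pwDl ?sumr_ge0//.
    by rewrite exprn_gt0// lt_neqAle d0 andbT eq_sym; apply/eqP.
  by move=> i _; exact: sqr_ge0.
move=> y Qy.
under eq_bigr do rewrite mulrAC.
rewrite -mulr_suml ler_pdivlMr// divfK ?gt_eqF//.
have dd i : d i * b i c = - d i ^+ 2.
  by rewrite /d; case: (leP 0 (- b i c)) => h; ring.
have := key y Qy.
under eq_bigr do rewrite mulrBr dd opprK.
by rewrite big_split/= -lerBrDr sub0r.
Qed.

(** * The minimax argument *)

Lemma expectation_sum (R : realType) (X : ptopologicalType) (I : Type)
    (s : seq I) (lam : I -> R) (f : I -> X -> R)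
    (mu : probability (borel X) R) :
  (forall i, Cb R X (f i)) ->
  \int[mu]_x (\sum_(i <- s) lam i * f i x) =
  \sum_(i <- s) lam i * \int[mu]_x f i x.
Proof.
move=> Cf; have Clam i := CbZ (lam i) (Cf i).
rewrite /Rintegral; under eq_integral do rewrite -sumEFin.
rewrite integral_sum//; last by move=> i; exact: (Cb_integrable _ (Clam i)).
under eq_bigr => i _.
  rewrite -(fineK (integrable_fin_num measurableT (Cb_integrable mu (Clam i)))).
  over.
rewrite sumEFin/=; apply: eq_bigr => i _.
by apply: RintegralZl => //; exact: Cb_integrable.
Qed.

(** Jensen's inequality, by summing the tangent line of [expR] at the mean. *)
Lemma convex_expR_sum (R : realType) (I : finType) (lam u : I -> R) :
  (forall i, 0 <= lam i) -> \sum_i lam i = 1 ->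
  expR (\sum_i lam i * u i) <= \sum_i lam i * expR (u i).
Proof.
move=> lam0 lam1; set m := \sum_i lam i * u i.
have : \sum_i lam i * (expR m * (1 + (u i - m))) <= \sum_i lam i * expR (u i).
  apply: ler_sum => i _; rewrite ler_wpM2l//.
  have -> : expR (u i) = expR m * expR (u i - m) by rewrite -expRD addrC subrK.
  by rewrite ler_wpM2l ?expR_ge0// expR_ge1Dx.
apply: le_trans; rewrite le_eqVlt; apply/orP; left; apply/eqP.
transitivity (expR m * (\sum_i lam i + (m - m * \sum_i lam i))).
  by rewrite lam1 mulr1 subrr addr0 mulr1.
rewrite /m [X in _ + (_ - X)]mulr_sumr -sumrB -big_split mulr_sumr/=.
by apply: eq_bigr => i _; ring.
Qed.

(** The functions [psi i = phi i + c - E_mu (phi i)] all have [mu]-expectation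
    [c], and the goal says [E_nu (e^psi i) >= 1].  If no [nu] achieves this for
    all [i], the alternative provides weights [lam] with
    [E_nu (\sum_i lam i e^psi i) <= 1 + r < 1] on [Q].  By Jensen,
    [f = \sum_i lam i psi i] then has [E_nu (e^f) <= 1 + r] on [Q] although
    [E_mu f = c], which the hypothesis on test functions excludes. *)
Lemma finite_minimax (R : realType) (X : ptopologicalType)
    (mu : probability (borel X) R) (Q : set (probability (borel X) R)) (c : R)
    (I : finType) (phi : I -> X -> R) :
  Q !=set0 -> weakly_compact Q -> convex_probabilities Q ->
  (forall f, Cb R X f -> forall r,
     (forall nu, Q nu -> \int[nu]_x expR (f x) <= r) ->
     expR (\int[mu]_x f x - c) <= r) ->
  (forall i, Cb R X (phi i)) ->
  exists2 nu, Q nu & forall i,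
    expR (\int[mu]_x phi i x - c) <= \int[nu]_x expR (phi i x).
Proof.
move=> Q0 cQ convQ H Cphi.
pose a i := c - \int[mu]_x phi i x.
pose psi i x := phi i x + a i.
have Cpsi i : Cb R X (psi i).
  by apply: CbD => //; exact: Cb_cst.
have psiE (nu : probability (borel X) R) i :
    \int[nu]_x psi i x = \int[nu]_x phi i x + a i.
  rewrite RintegralD//.
  - by rewrite Rintegral_cst_probability.
  - exact: Cb_integrable.
  - exact: integrable_cst_probability.
have expE (nu : probability (borel X) R) i : \int[nu]_x expR (psi i x) =
    expR (a i) * \int[nu]_x expR (phi i x).
  rewrite -RintegralZl//; last by apply: Cb_integrable; exact: Cb_expR.
  by apply: eq_Rintegral => x _; rewrite expRD mulrC.
pose b i (nu : weak_probability R X) := \int[nu]_x expR (psi i x) - 1.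
have cb i : continuous (b i).
  have cE := continuous_expectation (Cb_expR (Cpsi i)).
  move=> nu; exact: (cvgB (cE nu) (cvg_cst (1 : R))).
have convb (nu1 nu2 : weak_probability R X) : Q nu1 -> Q nu2 ->
    forall t, 0 <= t <= 1 ->
    exists2 rho, Q rho & forall i, b i rho = t * b i nu1 + (1 - t) * b i nu2.
  move=> Q1 Q2 t t01; have [rho Qrho rhoE] := convQ _ _ Q1 Q2 t t01.
  exists rho; first exact: Qrho.
  move=> i; have /CbP[ce be] := Cb_expR (Cpsi i).
  have E : \int[rho]_x expR (psi i x) =
      t * \int[nu1]_x expR (psi i x) + (1 - t) * \int[nu2]_x expR (psi i x).
    apply: (Rintegral_mixture t01 rhoE) => //; exact: measurable_continuous.
  by rewrite /b E; ring.
have [[nu Qnu bnu]|[lam [lam0 lam1 [r r0 lamr]]]] :=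
  @convex_alternative R (weak_probability R X) I Q b Q0 cQ cb convb.
  exists nu => // i; have := bnu i.
  rewrite /b subr_ge0 expE /a => h.
  have -> : \int[mu]_x phi i x - c = - (c - \int[mu]_x phi i x) by ring.
  by rewrite expRN -div1r ler_pdivrMr ?expR_gt0// mulrC.
have Cf : Cb R X (fun x => \sum_i lam i * psi i x).
  by apply: Cb_sum => i; exact: CbZ.
have := H _ Cf (1 + r).
rewrite expectation_sum//.
under eq_bigr do rewrite psiE /a addrCA subrr addr0.
rewrite -mulr_suml lam1 mul1r subrr expR0 => h; exfalso.
suff : 1 <= 1 + r by lra.
apply: h => nu Qnu.
have CE i : Cb R X (fun x => expR (psi i x)) by exact: Cb_expR.
apply: (@le_trans _ _ (\int[nu]_x \sum_i lam i * expR (psi i x))).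
  apply: le_Rintegral => //.
  - by apply: Cb_integrable; exact: Cb_expR.
  - by apply: Cb_integrable; apply: Cb_sum => i; exact: CbZ.
  - by move=> x _; exact: convex_expR_sum.
rewrite expectation_sum//.
have := lamr nu Qnu; rewrite /b.
under eq_bigr do rewrite mulrBr mulr1.
rewrite sumrB lam1; lra.
Qed.

(** For each [f] the admissible [nu] form a closed set, and [finite_minimax] is
    the finite intersection property. *)
Lemma compact_minimax (R : realType) (X : ptopologicalType)
    (mu : probability (borel X) R) (Q : set (probability (borel X) R)) (c : R) :
  Q !=set0 -> weakly_compact Q -> convex_probabilities Q ->
  (forall f, Cb R X f -> forall r,
     (forall nu, Q nu -> \int[nu]_x expR (f x) <= r) ->
     expR (\int[mu]_x f x - c) <= r) ->
  exists2 nu, Q nu & forall f, Cb R X f ->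
    expR (\int[mu]_x f x - c) <= \int[nu]_x expR (f x).
Proof.
move=> Q0 cQ convQ H.
pose K (f : X -> R) : set (weak_probability R X) :=
  [set nu : weak_probability R X |
    expR (\int[mu]_x f x - c) <= \int[nu]_x expR (f x)].
have := cQ; rewrite /weakly_compact compact_In0 => /(_ (X -> R) (Cb R X)
  (fun f => (Q : set (weak_probability R X)) `&` K f)).
case.
- exists K => // f Cf.
  apply: (@closed_comp _ _ (fun nu : weak_probability R X =>
      \int[nu]_x expR (f x)) [set y | expR (\int[mu]_x f x - c) <= y]).
    by move=> nu _; apply: (continuous_expectation (Cb_expR Cf)).
  exact: closed_ge.
- move=> D' D'C.
  pose s := finmap.enum_fset D'.
  have [|nu Qnu nuK] := @finite_minimax R X mu Q c 'I_(size s)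
    (fun i => nth (fun=> 0) s i) Q0 cQ convQ H.
    by move=> i; exact: set_mem (D'C _ (mem_nth (fun=> 0) (ltn_ord i))).
  exists nu => f /= fD'; split => //.
  have fs : (index f s < size s)%N by rewrite index_mem.
  by have := nuK (Ordinal fs); rewrite /= nth_index.
- move=> nu nuK; have [Qnu _] : (Q `&` K (fun=> 0)) nu.
    by apply: nuK; exact: Cb_cst.
  by exists nu => // f /nuK[].
Qed.

(** * The dual formula *)

Local Open Scope ereal_scope.

Lemma EFin_expectation (R : realType) (X : ptopologicalType)
    (mu : probability (borel X) R) (f : X -> R) : Cb R X f ->
  (\int[mu]_x f x)%:E = \int[mu]_x (f x)%:E.
Proof.
by move=> Cf; exact/fineK/integrable_fin_num/Cb_integrable.
Qed.

Lemma upper_expectation_expR (R : realType) (X : ptopologicalType)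
    (Q : set (probability (borel X) R)) (f : X -> R) : Q !=set0 -> Cb R X f ->
  exists2 S : R, (0 < S)%R & upper_expectation Q (fun x => expR (f x)) = S%:E.
Proof.
move=> [nu Qnu] Cf; have Cef := Cb_expR Cf.
have /CbP[_ [M fM]] := Cf.
have mef : measurable_fun setT (fun x : borel X => (expR (f x))%:E).
  by apply/measurable_EFinP; apply: measurable_continuous; case/CbP: Cef.
set S := upper_expectation _ _.
have Sub : S <= (expR M)%:E.
  apply: ge_ereal_sup => _ [m _ <-].
  rewrite -(integral_cst_probability m (expR M)).
  apply: le_measurable_integral => // x.
  by rewrite lee_fin ler_expR (le_trans (ler_norm _)).
have Slb : (expR (- M))%:E <= S.
  apply: (@le_trans _ _ (\int[nu]_x (expR (f x))%:E)).
    rewrite -(integral_cst_probability nu (expR (- M))).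
    apply: le_measurable_integral => // x.
    by rewrite lee_fin ler_expR; have := fM x; rewrite ler_norml => /andP[].
  by apply: ereal_sup_ubound; exists nu.
have Sfin : S \is a fin_num.
  by rewrite fin_real// (lt_le_trans (ltNyr _) Slb) (le_lt_trans Sub (ltry _)).
exists (fine S); last by rewrite fineK.
by rewrite -lte_fin fineK// (lt_le_trans _ Slb)// lte_fin expR_gt0.
Qed.

Lemma Donsker_Varadhan_sub_ln (R : realType) (X : ptopologicalType)
    (mu nu : probability (borel X) R) (f : X -> R) (S : R) : Cb R X f ->
  (0 < S)%R -> (\int[nu]_x expR (f x) <= S)%R ->
  \int[mu]_x (f x)%:E - (ln S)%:E <= KL mu nu.
Proof.
move=> Cf S0 nuS; have /CbP[cf [M fM]] := Cf.
have -> : \int[mu]_x (f x)%:E - (ln S)%:E = \int[mu]_x (f x - ln S)%:E.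
  under [RHS]eq_integral do rewrite EFinB.
  rewrite integralB_EFin//; last 2 first.
  - exact: Cb_integrable.
  - exact: integrable_cst_probability.
  by rewrite integral_cst_probability.
apply: Donsker_Varadhan_le.
- by apply: measurable_funB => //; exact: measurable_continuous.
- exists (M + `|ln S|)%R => x; rewrite (le_trans (ler_normB _ _))//.
  by rewrite lerD2r.
- under eq_integral => x _.
    rewrite (_ : expR _ = S^-1 * expR (f x))%R; last first.
      by rewrite expRB lnK ?posrE// mulrC.
    over.
  rewrite -EFin_expectation; last by apply: CbZ; exact: Cb_expR.
  rewrite RintegralZl//; last by apply: Cb_integrable; exact: Cb_expR.
  by rewrite lee_fin mulrC ler_pdivrMr// mul1r.
Qed.

Theorem theorem4 (R : realType) (X : ptopologicalType)
    (P Q : set (probability (borel X) R))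
    (polishX : polish R X)
    (P0 : P !=set0) (Q0 : Q !=set0)
    (compactP : weakly_compact P) (compactQ : weakly_compact Q)
    (convexP : convex_probabilities P) (convexQ : convex_probabilities Q) :
  KL_sets P Q =
  ereal_sup [set upper_expectation P phi -
                 lne (upper_expectation Q (fun x => expR (phi x)))
            | phi in Cb R X].
Proof.
apply/eqP; rewrite eq_le; apply/andP; split; last first.
  apply: ge_ereal_sup => _ [phi Cphi <-].
  have [S S0 SE] := upper_expectation_expR Q0 Cphi.
  rewrite SE lne_EFin// leeBlDr//; apply: ge_ereal_sup => _ [mu Pmu <-].
  rewrite -leeBlDr//; apply: le_trans (ereal_sup_ubound _); last by exists mu.
  apply: le_ereal_inf_tmp => _ [nu Qnu <-].
  apply: Donsker_Varadhan_sub_ln => //.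
  rewrite -lee_fin -SE EFin_expectation; last exact: Cb_expR.
  by apply: ereal_sup_ubound; exists nu.
set s := ereal_sup [set _ | phi in _].
have value mu phi S : P mu -> Cb R X phi -> (0 < S)%R ->
    upper_expectation Q (fun x => expR (phi x)) = S%:E ->
    (\int[mu]_x phi x - ln S)%:E <= s.
  move=> Pmu Cphi S0 SE; apply: le_trans (ereal_sup_ubound _); last first.
    by exists phi => //; reflexivity.
  rewrite SE lne_EFin// EFinB leeD2r// EFin_expectation//.
  by apply: ereal_sup_ubound; exists mu.
apply: ge_ereal_sup => _ [mu Pmu <-].
(* The zero test function has a finite value. *)
have C0 := @Cb_cst R X 0%R.
have sNy : -oo < s.
  have [S S0 SE] := upper_expectation_expR Q0 C0.
  exact: lt_le_trans (ltNyr _) (value mu _ S Pmu C0 S0 SE).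
case: (s) sNy value => [c _ value|_ _|//]; last exact: leey.
have [nu Qnu nuK] : exists2 nu, Q nu & forall f, Cb R X f ->
    (expR (\int[mu]_x f x - c) <= \int[nu]_x expR (f x))%R.
  apply: compact_minimax => // f Cf r Qr.
  have [S S0 SE] := upper_expectation_expR Q0 Cf.
  have Sr : (S <= r)%R.
    rewrite -lee_fin -SE; apply: ge_ereal_sup => _ [nu Qnu <-].
    by rewrite -EFin_expectation ?lee_fin; [exact: Qr|exact: Cb_expR].
  apply: le_trans Sr; rewrite -[leRHS](lnK S0) ler_expR lerBlDr addrC -lerBlDr.
  by rewrite -lee_fin; exact: value.
apply: (@le_trans _ _ (KL mu nu)); first by apply: ereal_inf_lbound; exists nu.
by apply: KL_le_of_Cb_exp_bound => //; case: polishX.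
Qed.
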